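(* Let $X$, $Y$ be Banach spaces and $T,S\in B(X,Y)$. Then there is an analytic generalized resolvent for the linear pencil $\lambda\mapsto T-\lambda S$ on a neighborhood of $0$ if and only if there exists a neighborhood $U(0)$ of $0$ such that for every $\lambda\in U(0)$ the operator $T-\lambda S$ has a generalized inverse $(T-\lambda S)^+$, these generalized inverses satisfying $$\lim_{\lambda\to 0}(T-\lambda S)^+=T^+$$ in operator norm, where $T^+$ is a generalized inverse of $T$ (the one chosen at $\lambda=0$).
   Context: All spaces are complex. $B(X,Y)$ is the Banach space of bounded linear operators from $X$ to $Y$. A generalized inverse of $A\in B(X,Y)$ is an operator $A^+\in B(Y,X)$ with $AA^+A=A$ and $A^+AA^+=A^+$ (it is not unique in general; $(T-\lambda S)^+$ denotes a chosen one for each $\lambda$). For an open set $U\subset\mathbb{C}$, a function $U\ni\lambda\mapsto G(\lambda)\in B(Y,X)$ is a generalized resolvent on $U$ of the linear pencil $\lambda\mapsto T-\lambda S$ if: (i) $(T-\lambda S)G(\lambda)(T-\lambda S)=T-\lambda S$ for all $\lambda\in U$; (ii) $G(\lambda)(T-\lambda S)G(\lambda)=G(\lambda)$ for all $\lambda\in U$; (iii) $G(\lambda)-G(\mu)=(\lambda-\mu)G(\lambda)SG(\mu)$ for all $\lambda,\mu\in U$. It is an analytic generalized resolvent if moreover $\lambda\mapsto G(\lambda)$ is analytic on $U$. Neighborhoods of $0$ are open subsets of $\mathbb{C}$ containing $0$. *)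

(* Defs.v *)
From HB Require Import structures.
From mathcomp Require Import all_boot all_order all_algebra.
From mathcomp Require Import complex.
From mathcomp Require Import boolp classical_sets functions reals topology.
From mathcomp Require Import normedtype sequences.

Set Implicit Arguments.
Unset Strict Implicit.
Unset Printing Implicit Defensive.

Import Order.TTheory GRing.Theory Num.Theory.
Import numFieldNormedType.Exports.

Local Open Scope classical_set_scope.
Local Open Scope ring_scope.
Local Open Scope complex_scope.

(* The topology of [R[i]] is the one of its modulus. *)
HB.instance Definition _ (R : realType) := NormedModule.copy R[i] R[i]^o.

Section BoundedOperators.
Variable R : realType.

Lemma real_complexD (x y : R) : (x + y)%:C = x%:C + y%:C.
Proof. exact: (rmorphD (real_complex R)). Qed.

Lemma real_complexM (x y : R) : (x * y)%:C = x%:C * y%:C.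
Proof. exact: (rmorphM (real_complex R)). Qed.

Lemma Re_normK (V : normedModType R[i]) (v : V) :
  (complex.Re `|v|)%:C = `|v|.
Proof. by rewrite RRe_real ?normr_real. Qed.

Lemma Re_normcK (z : R[i]) : (complex.Re `|z|)%:C = `|z|.
Proof. by rewrite RRe_real ?normr_real. Qed.

Section Def.
Variables X Y : normedModType R[i].

Definition bounded_linear : {pred X -> Y} :=
  fun f => `[< linear f /\ exists M : R, forall x, `|f x| <= M%:C * `|x| >].

Lemma bounded_linearP (f : X -> Y) :
  reflect (linear f /\ exists M : R, forall x, `|f x| <= M%:C * `|x|)
          (f \in bounded_linear).
Proof. exact: asboolP. Qed.

Lemma bounded_linear_submod_closed : submod_closed bounded_linear.
Proof.
split.
  apply/bounded_linearP; split; first by move=> a x y; rewrite /= scaler0 addr0.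
  by exists 0 => x; rewrite normr0 mul0r.
move=> a f g /bounded_linearP[lf [M Mf]] /bounded_linearP[lg [N Ng]].
apply/bounded_linearP; split.
  move=> b x y; rewrite -![(a *: f + g) _]/(a *: f _ + g _) lf lg.
  rewrite !scalerDr !scalerA (mulrC a b) -!addrA; congr (_ + _).
  by rewrite !addrA; congr (_ + _); rewrite addrC.
exists (complex.Re `|a| * M + N) => x.
rewrite -![(a *: f + g) _]/(a *: f _ + g _) real_complexD real_complexM Re_normcK.
rewrite mulrDl -mulrA (le_trans (ler_normD _ _))// lerD//.
by rewrite normrZ ler_wpM2l.
Qed.

HB.instance Definition _ := GRing.isSubmodClosed.Build R[i] (X -> Y)
  bounded_linear bounded_linear_submod_closed.

Record blinop := BLinop {
  blinop_fun :> X -> Y;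
  _ : blinop_fun \in bounded_linear }.

HB.instance Definition _ := [isSub for blinop_fun].
HB.instance Definition _ := [Choice of blinop by <:].
HB.instance Definition _ := [SubChoice_isSubLmodule of blinop by <:].

Lemma blinopP (f : blinop) : (f : X -> Y) \in bounded_linear.
Proof. by case: f. Qed.

Lemma blinop_ext (f g : blinop) : (forall x, f x = g x) -> f = g.
Proof. by move=> fg; apply/val_inj/funext. Qed.

Lemma blinop_linear (f : blinop) : linear f.
Proof. by have /bounded_linearP[] := blinopP f. Qed.

HB.instance Definition _ (f : blinop) :=
  GRing.isLinear.Build R[i] X Y _ f (blinop_linear f).

(* Norms of an [R[i]]-normed space take values in [R[i]], where they are real;
   [complex.Re] brings them to [R], where suprema exist. *)
Definition unit_ball_norms (f : X -> Y) : set R :=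
  [set complex.Re `|f x| | x in [set x : X | `|x| <= 1]].

Definition opnorm (f : X -> Y) : R := sup (unit_ball_norms f).

Lemma opnorm_has_sup (f : blinop) : has_sup (unit_ball_norms f).
Proof.
have /bounded_linearP[lf [M Mf]] := blinopP f; split.
  by exists (complex.Re `|f 0|), 0 => //=; rewrite normr0.
exists `|M| => _ [x /= x1 <-]; rewrite -lecR Re_normK.
have M1 : `|f x| <= `|M|%:C * `|x|.
  by rewrite (le_trans (Mf x))// ler_wpM2r// lecR ler_norm.
by rewrite (le_trans M1)// ler_piMr// ler0c.
Qed.

Lemma opnorm_ge0 (f : blinop) : 0 <= opnorm f.
Proof.
have -> : 0 = complex.Re `|f 0| by rewrite linear0 normr0.
by apply: sup_upper_bound; [exact: opnorm_has_sup|exists 0 => //=; rewrite normr0].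
Qed.

Lemma ler_opnorm (f : blinop) x : `|f x| <= (opnorm f)%:C * `|x|.
Proof.
have [->|x0] := eqVneq x 0; first by rewrite linear0 !normr0 mulr0.
rewrite -ler_pdivrMr ?normr_gt0// mulrC.
have -> : `|x|^-1 * `|f x| = `|f (`|x|^-1 *: x)|.
  by rewrite linearZ normrZ normfV normr_id.
rewrite -Re_normK lecR; apply: sup_upper_bound; first exact: opnorm_has_sup.
exists (`|x|^-1 *: x) => //=.
by rewrite normrZ normfV normr_id mulVf ?normr_eq0.
Qed.

Lemma opnorm_le (f : blinop) (M : R) : 0 <= M ->
  (forall x, `|f x| <= M%:C * `|x|) -> opnorm f <= M.
Proof.
move=> M0 fM; apply: ge_sup; first by case: (opnorm_has_sup f).
move=> _ [x /= x1 <-]; rewrite -lecR Re_normK (le_trans (fM x))//.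
by rewrite ler_piMr// ler0c.
Qed.

Lemma opnormD (f g : blinop) : opnorm (f + g) <= opnorm f + opnorm g.
Proof.
apply: opnorm_le => [|x]; first by rewrite addr_ge0 ?opnorm_ge0.
rewrite real_complexD mulrDl (le_trans (ler_normD _ _))//.
by rewrite lerD ?ler_opnorm.
Qed.

Lemma opnormZ_le (a : R[i]) (f : blinop) :
  opnorm (a *: f) <= complex.Re `|a| * opnorm f.
Proof.
apply: opnorm_le => [|x].
  by rewrite mulr_ge0 ?opnorm_ge0// -ler0c Re_normcK.
rewrite real_complexM Re_normcK -mulrA [X in `|X|](_ : _ = a *: f x)//.
by rewrite normrZ ler_wpM2l// ler_opnorm.
Qed.

Definition blinop_norm (f : blinop) : R[i] := (opnorm f)%:C.

Lemma blinop_normD (f g : blinop) :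
  blinop_norm (f + g) <= blinop_norm f + blinop_norm g.
Proof. by rewrite -real_complexD lecR opnormD. Qed.

Lemma blinop_normZ (a : R[i]) (f : blinop) :
  blinop_norm (a *: f) = `|a| * blinop_norm f.
Proof.
have le b g : blinop_norm (b *: g) <= `|b| * blinop_norm g.
  rewrite -[`|b|]Re_normcK -real_complexM lecR.
  exact: opnormZ_le.
apply/eqP; rewrite eq_le le/=.
have [->|a0] := eqVneq a 0; first by rewrite normr0 mul0r ler0c opnorm_ge0.
rewrite mulrC -ler_pdivlMr ?normr_gt0// mulrC -normfV.
by rewrite -{1}(scalerK a0 f) le.
Qed.

Lemma blinop_norm_eq0 (f : blinop) : blinop_norm f = 0 -> f = 0.
Proof.
move=> f0; apply: blinop_ext => x; apply/eqP.
by rewrite -normr_le0 (le_trans (ler_opnorm f x))// -/(blinop_norm f) f0 mul0r.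
Qed.

HB.instance Definition _ := Lmodule_isNormed.Build R[i] blinop
  blinop_normD blinop_normZ blinop_norm_eq0.

Lemma blinop_normE (f : blinop) : `|f| = (opnorm f)%:C.
Proof. by []. Qed.

End Def.

Section Comp.
Variables X Y Z : normedModType R[i].

Lemma blinop_comp_subproof (A : blinop Y Z) (B : blinop X Y) :
  (A \o B : X -> Z) \in @bounded_linear X Z.
Proof.
apply/bounded_linearP; split; first by move=> a x y /=; rewrite !linearP.
exists (opnorm A * opnorm B) => x /=.
rewrite (le_trans (ler_opnorm A _))// real_complexM -mulrA ler_wpM2l ?ler_opnorm//.
by rewrite ler0c opnorm_ge0.
Qed.

Definition blinop_comp (A : blinop Y Z) (B : blinop X Y) : blinop X Z :=
  BLinop (blinop_comp_subproof A B).

End Comp.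
End BoundedOperators.

Arguments bounded_linear {R X Y}.

Notation "''B' ( X , Y )" := (blinop X Y)
  (at level 8, format "''B' ( X ,  Y )") : type_scope.
Notation "A \oB B" := (blinop_comp A B)
  (at level 40, left associativity, format "A  \oB  B") : ring_scope.

Definition nbhd0 (R : realType) (U : set R[i]) : Prop := open U /\ U 0.

(* Local norm-convergent power series expansion at every point of [U]; values
   of [f] outside [U] are irrelevant when [U] is open. *)
Definition analytic_on (R : realType) (V : normedModType R[i])
    (U : set R[i]) (f : R[i] -> V) : Prop :=
  forall z0, U z0 -> exists a : nat -> V,
    \forall z \near z0, series (fun k => (z - z0) ^+ k *: a k) @ \oo --> f z.

Section Pencil.
Variables (R : realType) (X Y : normedModType R[i]).

Definition generalized_inverse (A : 'B(X, Y)) (B : 'B(Y, X)) : Prop :=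
  A \oB B \oB A = A /\ B \oB A \oB B = B.

Definition pencil (T S : 'B(X, Y)) (l : R[i]) : 'B(X, Y) := T - l *: S.

Definition generalized_resolvent (T S : 'B(X, Y)) (U : set R[i])
    (G : R[i] -> 'B(Y, X)) : Prop :=
  [/\ forall l, U l -> pencil T S l \oB G l \oB pencil T S l = pencil T S l,
      forall l, U l -> G l \oB pencil T S l \oB G l = G l
    & forall l m, U l -> U m -> G l - G m = (l - m) *: (G l \oB S \oB G m)].

Definition analytic_generalized_resolvent (T S : 'B(X, Y)) (U : set R[i])
    (G : R[i] -> 'B(Y, X)) : Prop :=
  generalized_resolvent T S U G /\ analytic_on U G.

End Pencil.

(* Main.v *)
Require Import Defs.
From mathcomp Require Import all_boot all_order all_algebra.
From mathcomp Require Import complex.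
From mathcomp Require Import boolp classical_sets functions reals topology.
From mathcomp Require Import normedtype sequences.

Import GRing.Theory numFieldNormedType.Exports.

Local Open Scope classical_set_scope.
Local Open Scope ring_scope.
Local Open Scope complex_scope.

(* If [G] satisfies the resolvent identity, then
   [|G l| <= |G 0| + |l| |G l| |S| |G 0|] bounds [G] near [0], and the identity
   then gives [G l --> G 0].  Conversely put [G l = (1 - l P S)^-1 P] with
   [P = P 0].  The resolvent identity and [G l (T - l S) G l = G l] are
   algebraic.  The remaining equation amounts to
   [range (T - l S) /\ ker P = 0], since
   [P (T - l S) G l = P]; this follows from the convergence of the [P l].
   Analyticity comes from iterating the resolvent identity: the remainder of the
   Taylor polynomial of degree [n - 1] at [z0] is
   [(z - z0)^n (G z0 S)^n (G z)]. *)

Import Order.TTheory Num.Theory.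

(** * Submultiplicativity of the operator norm *)

Section OperatorNorm.
Context {R : realType} {X Y Z : normedModType R[i]}.

Lemma blinop_normM (A : 'B(X, Y)) x : `|A x| <= `|A| * `|x|.
Proof. exact: ler_opnorm. Qed.

Lemma blinop_norm_comp (A : 'B(Y, Z)) (B : 'B(X, Y)) :
  `|A \oB B| <= `|A| * `|B|.
Proof.
rewrite !blinop_normE -real_complexM lecR; apply: opnorm_le => [|x].
  by rewrite mulr_ge0 ?opnorm_ge0.
rewrite real_complexM -mulrA (le_trans (ler_opnorm A _))// ler_wpM2l//.
  by rewrite ler0c opnorm_ge0.
exact: ler_opnorm.
Qed.

Lemma blinop_comp_linearr (A : 'B(Y, Z)) : linear (@blinop_comp R X Y Z A).
Proof. by move=> a B C; apply: blinop_ext => x; exact: (linearP A). Qed.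

End OperatorNorm.

(** The order of [R[i]] forces [q] and [e] to be real, so the claim descends to geometric sequences
    in [R]. *)
Lemma complex_exprn_lt {R : realType} (q e : R[i]) : 0 <= q -> q < 1 -> 0 < e ->
  \forall n \near \oo, q ^+ n < e.
Proof.
move=> q0 q1 e0.
have qE : q = (complex.Re q)%:C by rewrite RRe_real ?ger0_real.
have eE : e = (complex.Re e)%:C by rewrite RRe_real ?gtr0_real.
move: q0 q1 e0; rewrite qE eE => {qE eE}; set r := complex.Re q.
set d := complex.Re e.
rewrite ler0c => r0; rewrite -[1]/(1%:C) ltcR => r1.
rewrite -[X in X < _]/(0%:C) ltcR => d0.
have /cvgr0Pnorm_lt/(_ d d0) : (r ^+ n) @[n --> \oo] --> (0 : R).
  by apply: cvg_expr; rewrite ger0_norm.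
apply: filterS => n; rewrite ger0_norm ?exprn_ge0// => rd.
by rewrite -(rmorphXn (real_complex R)) ltcR.
Qed.

(** * Neumann series: inverting [1 - K] for a contraction [K] *)

Section Neumann.
Context {R : realType} {X : completeNormedModType R[i]}.
Variable K : 'B(X, X).
Hypothesis K1 : `|K| < 1.

Lemma contraction_id_sub_inj x : x = K x -> x = 0.
Proof.
move=> xK; apply/eqP; apply: contraT => x0.
have : `|x| <= `|K| * `|x| by rewrite {1}xK blinop_normM.
by rewrite ler_pMl ?normr_gt0// => /(lt_le_trans K1); rewrite ltxx.
Qed.

Lemma neumann_solution y : exists x, x = y + K x.
Proof.
(* The iterates from [0] are the partial sums of the Neumann series of [y]. The constant [C] solves
   [|y| + |K| C = C], so the ball of radius [C] is stable. *)
pose s n := iter n (fun x => y + K x) 0.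
pose C := `|y| / (1 - `|K|).
have K1' : 0 < 1 - `|K| by rewrite subr_gt0.
have C0 : 0 <= C by rewrite divr_ge0// ltW.
have sC m : `|s m| <= C.
  elim: m => [|m IH]; first by rewrite normr0.
  rewrite /= (le_trans (ler_normD _ _))//.
  rewrite -lerBrDl (le_trans (blinop_normM _ _))//.
  rewrite (le_trans (ler_wpM2l _ IH))// lerBrDl -lerBrDr -{1}[C]mul1r -mulrBl.
  by rewrite /C mulrC divfK// gt_eqF.
have sD n m : `|s n - s (n + m)%N| <= `|K| ^+ n * C.
  elim: n => [|n IH]; first by rewrite sub0r normrN expr0 mul1r.
  rewrite addSn /= -/(s n) -/(s (n + m)%N) opprD addrACA subrr add0r.
  rewrite -linearB (le_trans (blinop_normM _ _))//.
  by rewrite exprS -mulrA ler_wpM2l.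
have /cauchy_cvgP cs : cauchy (s n @[n --> \oo]).
  apply: cauchy_exP => e e0.
  (* [C + 1] replaces [C], which vanishes when [y = 0]. *)
  have eC : 0 < e / (C + 1) by rewrite divr_gt0// ltr_wpDl.
  have [N _ HN] := complex_exprn_lt _ _ (normr_ge0 K) K1 eC.
  exists (s N); exists N => // n /= Nn.
  rewrite -ball_normE /= -(subnKC Nn) (le_lt_trans (sD _ _))//.
  have /= := HN N (leqnn N).
  rewrite ltr_pdivlMr ?ltr_wpDl//; apply: le_lt_trans.
  by rewrite ler_wpM2l ?exprn_ge0// lerDl.
pose x := lim (s n @[n --> \oo]); exists x.
have sx : s n @[n --> \oo] --> x by exact: cs.
(* The shifted sequence tends both to [x] and, by contraction, to [y + K x]. *)
apply: (@cvg_unique _ _ ((fun n => s n.+1) @ \oo)).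
- exact: norm_hausdorff.
- by move: sx; rewrite -(cvg_shiftS s).
- apply/cvgrPdist_lt => e e0; move/cvgrPdist_lt/(_ e e0): sx.
  apply: filterS => n; apply: le_lt_trans.
  rewrite /= -/(s n) opprD addrACA subrr add0r -linearB.
  by rewrite (le_trans (blinop_normM _ _))// ler_piMl// ltW.
Qed.

Lemma neumann_inverse : exists C : 'B(X, X),
  (forall x, C x - K (C x) = x) /\ (forall x, C (x - K x) = x).
Proof.
have [f fP] := choice neumann_solution.
have f_uniq x y : x = y + K x -> x = f y.
  move=> xE; apply/subr0_eq/contraction_id_sub_inj.
  rewrite linearB/= {1}xE {1}fP opprD addrACA subrr add0r//.
have flin : linear f.
  move=> a x y; symmetry; apply: f_uniq.
  rewrite linearP {1}(fP x) {1}(fP y) scalerDr.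
  by rewrite -!addrA; congr (_ + _); rewrite addrCA.
have K1' : 0 < 1 - `|K| by rewrite subr_gt0.
have fb : f \in bounded_linear.
  apply/bounded_linearP; split=> //; exists (complex.Re (1 - `|K|)^-1) => x.
  rewrite RRe_real; last by rewrite gtr0_real// invr_gt0.
  (* From [f x = x + K (f x)]: [|f x| <= |x| + |K| |f x|]. *)
  rewrite ler_pdivlMl// mulrBl mul1r lerBlDr {1}fP.
  by rewrite (le_trans (ler_normD _ _))// lerD2l blinop_normM.
exists (BLinop fb); split=> x /=; first by rewrite {1}fP addrK.
by symmetry; apply: f_uniq; rewrite subrK.
Qed.

End Neumann.

Section Resolvent.
Context {R : realType}.

(** * Analyticity and continuity from the resolvent identity *)

Section ResolventIdentity.
Context {X Y : normedModType R[i]} (S : 'B(X, Y)).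
Context (U : set R[i]) (G : R[i] -> 'B(Y, X)).
Hypothesis GU : forall l m, U l -> U m ->
  G l - G m = (l - m) *: (G l \oB S \oB G m).

Lemma resolvent_taylor_remainder z0 z n : U z0 -> U z ->
  let F : 'B(Y, X) -> 'B(Y, X) := blinop_comp (G z0 \oB S) in
  G z - series (fun k => (z - z0) ^+ k *: iter k F (G z0)) n =
  (z - z0) ^+ n *: iter n F (G z).
Proof.
move=> Uz0 Uz F.
(* The resolvent identity under [k] applications of [F]: each remainder splits into the next Taylor
   term and the next remainder. *)
have GE k : iter k F (G z) = (z - z0) *: iter k.+1 F (G z) + iter k F (G z0).
  elim: k => [|k IH]; last by rewrite /= {1}IH /F blinop_comp_linearr.
  by apply/eqP; rewrite -subr_eq -opprB GU// -scaleNr opprB.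
elim: n => [|n IH]; first by rewrite /series/= big_nil subr0 expr0 scale1r.
rewrite /series/= big_nat_recr//= opprD addrA -/(series _ n) IH.
by rewrite {1}GE scalerDr addrK scalerA -exprSr.
Qed.

Lemma resolvent_analytic : open U -> analytic_on U G.
Proof.
move=> oU z0 Uz0; pose F : 'B(Y, X) -> 'B(Y, X) := blinop_comp (G z0 \oB S).
pose c := `|G z0 \oB S|; have c0 : 0 <= c by exact: normr_ge0.
have c1 : 0 < c + 1 by rewrite ltr_wpDl.
exists (fun k => iter k F (G z0)); near=> z.
have Uz : U z by near: z; exact: open_nbhs_nbhs.
pose q := `|z - z0| * c.
have q0 : 0 <= q by rewrite mulr_ge0.
have q1 : q < 1.
  have : `|z - z0| < (c + 1)^-1.
    rewrite distrC; near: z; apply: (cvgr_dist_lt id z0) => //.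
    by rewrite invr_gt0.
  rewrite -[_^-1]mul1r ltr_pdivlMr//; apply: le_lt_trans.
  by rewrite ler_wpM2l// lerDl.
have Fn n : `|(z - z0) ^+ n *: iter n F (G z)| <= q ^+ n * `|G z|.
  rewrite normrZ normrX exprMn -mulrA ler_wpM2l ?exprn_ge0//.
  elim: n => [|n IH]; first by rewrite expr0 mul1r.
  rewrite /= (le_trans (blinop_norm_comp _ _))// exprS -mulrA.
  by rewrite ler_wpM2l.
apply/cvgrPdist_lt => e e0.
have eG : 0 < e / (`|G z| + 1) by rewrite divr_gt0// ltr_wpDl.
have := complex_exprn_lt _ _ q0 q1 eG; apply: filterS => n.
rewrite ltr_pdivlMr ?ltr_wpDl//; apply: le_lt_trans.
rewrite resolvent_taylor_remainder// (le_trans (Fn n))//.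
by rewrite ler_wpM2l ?exprn_ge0// lerDl.
Unshelve. all: by end_near. Qed.

Lemma resolvent_continuous0 : nbhd0 U -> G l @[l --> (0 : R[i])] --> G 0.
Proof.
move=> [oU U0].
apply: (cvgrPdist_lt (F := nbhs (0 : R[i])) G (G 0)).2 => e e0.
pose c := `|S| * `|G 0|; have c0 : 0 <= c by rewrite mulr_ge0.
have c1 : 0 < 2 * (c + 1) by rewrite mulr_gt0// ltr_wpDl.
have d1 : 0 < c * (`|G 0| *+ 2) + 1 by rewrite ltr_wpDl// mulr_ge0// mulrn_wge0.
near=> l.
have Ul : U l by near: l; exact: open_nbhs_nbhs.
have D : `|G 0 - G l| <= `|l| * c * `|G l|.
  rewrite distrC GU// subr0 normrZ -mulrA ler_wpM2l// mulrC.
  rewrite (le_trans (blinop_norm_comp _ _))// /c mulrA ler_wpM2r//.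
  exact: blinop_norm_comp.
(* With factor at most one half, the term in [|G l|] of the a priori bound is absorbed on the left,
   whence [|G l| <= 2 |G 0|]. *)
have lc : `|l| * c <= 2^-1.
  have : `|l| < (2 * (c + 1))^-1.
    by near: l; apply: nbhs0_lt; rewrite invr_gt0.
  rewrite invfM ltr_pdivlMr ?ltr_wpDl// => /ltW; apply: le_trans.
  by rewrite ler_wpM2l// lerDl.
have Gl : `|G l| <= `|G 0| *+ 2.
  have : `|G l| <= `|G 0| + 2^-1 * `|G l|.
    rewrite -[G l in X in X <= _](subrK (G 0)) addrC.
    rewrite (le_trans (ler_normD _ _))// lerD2l distrC (le_trans D)//.
    by rewrite ler_wpM2r.
  rewrite -lerBlDr -{1}[`|G l|]mul1r -mulrBl.
  have -> : 1 - 2^-1 = 2^-1 :> R[i] by rewrite {1}(splitr 1) div1r addrK.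
  by rewrite mulrC ler_pdivrMr// mulr_natr.
rewrite (le_lt_trans D)// (le_lt_trans (ler_wpM2l _ Gl)) ?mulr_ge0//.
have : `|l| < e / (c * (`|G 0| *+ 2) + 1).
  by near: l; apply: nbhs0_lt; rewrite divr_gt0.
rewrite ltr_pdivlMr//; apply: le_lt_trans.
by rewrite -mulrA ler_wpM2l// lerDl.
Unshelve. all: by end_near. Qed.

End ResolventIdentity.

(** * The resolvent built from one generalized inverse [P] of [T] *)

Section Construction.
Context {X : completeNormedModType R[i]} {Y : normedModType R[i]}.
Context (T S : 'B(X, Y)) (P : 'B(Y, X)).

(* Both equations say [G = (1 - l P S)^-1 P = P (1 - l S P)^-1]. *)
Definition resolvent_at (l : R[i]) (G : 'B(Y, X)) : Prop :=
  (forall y, G y = P y + l *: P (S (G y))) /\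
  (forall y, G y = P y + l *: G (S (P y))).

Lemma resolvent_at_exists l : `|l *: (P \oB S)| < 1 ->
  exists G, resolvent_at l G.
Proof.
move=> /neumann_inverse[C [CK KC]]; exists (C \oB P); split=> y /=.
  by rewrite -{2}(CK (P y)) /= subrK.
by rewrite -{2}(KC (P y)) linearB linearZ /= subrK.
Qed.

(** The equation of [Gm] with [P] on the left expresses [P y] through [Gm y] and [P z]; inserting
    this into the equation of [Gl] with [P] on the right leaves linear algebra in [Gl z] and
    [P z]. *)
Lemma resolvent_at_identity l m Gl Gm :
  resolvent_at l Gl -> resolvent_at m Gm ->
  Gl - Gm = (l - m) *: (Gl \oB S \oB Gm).
Proof.
move=> [_ Glr] [Gml _]; apply: blinop_ext => y.
rewrite -[LHS]/(Gl y - Gm y) -[RHS]/((l - m) *: Gl (S (Gm y))).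
set z := S (Gm y).
have Py : P y = Gm y - m *: P z by rewrite {1}Gml addrK.
have -> : Gl y = P y + (l *: Gl z - m *: (Gl z - P z)).
  have -> : Gl z - P z = l *: Gl (S (P z)).
    by rewrite [in LHS]Glr addrC addKr.
  rewrite scalerA mulrC -scalerA -scalerBr.
  have <- : Gl (S (P y)) = Gl z - m *: Gl (S (P z)).
    by rewrite Py !(linearB, linearZ).
  by rewrite Glr.
rewrite Gml opprD addrACA subrr add0r scalerBr opprB (addrC (m *: P z)).
by rewrite addrA addrK scalerBl.
Qed.

Hypothesis PTP : P \oB T \oB P = P.

Lemma resolvent_at_left l G : resolvent_at l G ->
  forall y, P (pencil T S l (G y)) = P y.
Proof.
move=> [Gl _] y.
(* [G] takes its values in the range of [P], on which [P T] is the identity. *)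
have PTG : P (T (G y)) = G y.
  rewrite Gl -linearZ -linearD; exact: (congr1 (fun A : 'B(Y, X) => A _) PTP).
rewrite -[pencil T S l _]/(T (G y) - l *: S (G y)) linearB linearZ /= PTG.
by rewrite {1}Gl addrK.
Qed.

(** Since [G = (1 + l G S) P], the value of [G] at a vector depends only on its image under [P], and
    [(T - l S) G y] has the same image as [y]. *)
Lemma resolvent_at_outer l G : resolvent_at l G ->
  G \oB pencil T S l \oB G = G.
Proof.
move=> Gl; apply: blinop_ext => y /=.
by case: (Gl) => _ Gr; rewrite Gr (resolvent_at_left _ _ Gl) -Gr.
Qed.

(** The defect [(T - l S) (G (T - l S) x - x)] lies in the range of the pencil and is killed by
    [P]. *)
Lemma resolvent_at_inner l G : resolvent_at l G ->
  (forall x, P (pencil T S l x) = 0 -> pencil T S l x = 0) ->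
  pencil T S l \oB G \oB pencil T S l = pencil T S l.
Proof.
move=> Gl inj; apply: blinop_ext => x /=; apply/subr0_eq.
rewrite -linearB; apply: inj.
rewrite (linearB (pencil T S l)) linearB -[RHS](subrr (P (pencil T S l x))).
by congr (_ - _); exact: resolvent_at_left.
Qed.

End Construction.

(* A vector [w] of the range of [T - l S] killed by [P 0] is fixed by
   [(T - l S) P l - T P 0], which is a contraction for small [l]. *)
Lemma range_pencil_ker_trivial {X Y : normedModType R[i]} (T S : 'B(X, Y))
    (U : set R[i]) (P : R[i] -> 'B(Y, X)) :
  nbhd0 U -> (forall l, U l -> generalized_inverse (T - l *: S) (P l)) ->
  P l @[l --> 0^'] --> P 0 ->
  \forall l \near 0,
    forall x, P 0 (pencil T S l x) = 0 -> pencil T S l x = 0.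
Proof.
move=> [oU U0] PU cP.
(* A bound for the norm of this map, rewritten as [T (P l - P 0) - l S P l]. *)
pose q l := `|T| * `|P l - P 0| + `|l| * `|S| * `|P l|.
have cq : q l @[l --> (0 : R[i])^'] --> (0 : R[i]).
  rewrite -[X in _ --> X](_ : `|T| * `|P 0 - P 0| +
    `|0 : R[i]| * `|S| * `|P 0| = 0); last by rewrite subrr !normr0 mulr0 !mul0r addr0.
  apply: cvgD.
    apply: cvgM; first exact: cvg_cst.
    by apply: cvg_norm; apply: cvgB => //; exact: cvg_cst.
  apply: cvgM; last exact: cvg_norm.
  apply: cvgM; last exact: cvg_cst.
  by apply: cvg_norm; apply: nbhs_dnbhs.
have q1 : \forall l \near 0, l != 0 -> `|q l| < 1.
  by move/cvgr0Pnorm_lt : cq => /(_ 1 ltr01).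
near=> l => x Px.
have Ul : U l by near: l; exact: open_nbhs_nbhs.
have [TPT _] := PU _ Ul.
have {}TPT y : pencil T S l (P l (pencil T S l y)) = pencil T S l y.
  exact: (congr1 (fun A : 'B(X, Y) => A y) TPT).
(* The limit is punctured, so [q1] is silent at [0]; there [T x = T (P 0 (T x))] suffices. *)
have [l0|l0] := eqVneq l 0.
  by move: Px TPT; rewrite l0 => Px TPT; rewrite -TPT Px linear0.
set w := pencil T S l x in Px *.
have wE : w = T ((P l - P 0) w) - l *: S (P l w).
  rewrite -[(P l - P 0) w]/(P l w - P 0 w) Px subr0.
  by rewrite {1}/w -TPT.
have q0 : 0 <= q l by rewrite addr_ge0// !mulr_ge0.
have wq : `|w| <= q l * `|w|.
  rewrite {1}wE (le_trans (ler_normB _ _))// mulrDl lerD//.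
    rewrite (le_trans (blinop_normM _ _))// -mulrA ler_wpM2l//.
    exact: blinop_normM.
  rewrite normrZ -!mulrA ler_wpM2l// (le_trans (blinop_normM _ _))//.
  by rewrite ler_wpM2l// blinop_normM.
apply/eqP; apply: contraT => w0; move: wq.
rewrite ler_pMl ?normr_gt0// => q1l.
have : `|q l| < 1 by move: l0; near: l.
by rewrite ger0_norm// => /(le_lt_trans q1l); rewrite ltxx.
Unshelve. all: by end_near. Qed.

End Resolvent.

Theorem theorem2p2 (R : realType) (X Y : completeNormedModType R[i])
    (T S : 'B(X, Y)) :
  (exists2 U : set R[i], nbhd0 U &
     exists G : R[i] -> 'B(Y, X), analytic_generalized_resolvent T S U G) <->
  (exists2 U : set R[i], nbhd0 U &
     exists P : R[i] -> 'B(Y, X),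
       (forall l, U l -> generalized_inverse (T - l *: S) (P l)) /\
       P l @[l --> 0^'] --> P 0).
Proof.
split=> [[U nU [G [[Gi Go Gr] _]]]|[U nU [P [PU cP]]]].
  exists U => //; exists G; split=> [l Ul|].
    by split; [exact: Gi | exact: Go].
  apply: cvg_trans (resolvent_continuous0 _ _ _ Gr nU).
  by apply: cvg_app; exact: nbhs_dnbhs.
have [_ PTP] := PU 0 nU.2; rewrite scale0r subr0 in PTP.
(* Taking the interior makes [V] open and turns [V 0] into a statement about all [l] near [0]. *)
pose V := [set l | `|l *: (P 0 \oB S)| < 1 /\
  forall x, P 0 (pencil T S l x) = 0 -> pencil T S l x = 0]^°.
have V0 : V 0.
  apply: filterI; last exact: range_pencil_ker_trivial nU PU cP.
  have c1 : 0 < `|P 0 \oB S| + 1 by rewrite ltr_wpDl.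
  near=> l; rewrite normrZ.
  have : `|l| < (`|P 0 \oB S| + 1)^-1.
    by near: l; apply: nbhs0_lt; rewrite invr_gt0.
  rewrite -[_^-1]mul1r ltr_pdivlMr//; apply: le_lt_trans.
  by rewrite ler_wpM2l// lerDl.
have oV : open V by exact: open_interior.
(* Outside [V] the value [0] is a mere default. *)
have /choice[G GV] l : exists G, V l -> resolvent_at S (P 0) l G.
  have [/interior_subset[Pl _]|nV] := pselect (V l); last by exists 0.
  by have [G ?] := resolvent_at_exists _ _ _ Pl; exists G.
have Gr l m : V l -> V m -> G l - G m = (l - m) *: (G l \oB S \oB G m).
  by move=> /GV Gl /GV Gm; exact: resolvent_at_identity Gl Gm.
exists V; first by [].
exists G; split; last exact: resolvent_analytic Gr oV.
split=> // l Vl.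
  by apply: resolvent_at_inner (GV _ Vl) _ => //; case: (interior_subset Vl).
exact: resolvent_at_outer PTP _ _ (GV _ Vl).
Unshelve. all: by end_near. Qed.
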